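(* Let $(Q,\cdot)$ be a quasigroup. Then $Q$ is trimedial if and only if it satisfies both of the following identities: $$(y\cdot z)\cdot(x\cdot x) = (y\cdot x)\cdot(z\cdot x)\quad\text{for all } x,y,z\in Q,$$ $$\bigl(x\cdot (x\cdot x)\bigr)\cdot(u\cdot v) = (x\cdot u)\cdot\bigl((x\cdot x)\cdot v\bigr)\quad\text{for all } x,u,v\in Q.$$
   Context: A groupoid is a set $G$ with a binary operation $\cdot$ (no further axioms assumed). A quasigroup is a groupoid $(Q,\cdot)$ such that for all $a,b\in Q$ the equations $a\cdot x=b$ and $y\cdot a=b$ have unique solutions $x,y\in Q$. A groupoid is medial if it satisfies the identity $(w\cdot x)\cdot(y\cdot z)=(w\cdot y)\cdot(x\cdot z)$ for all $w,x,y,z$. A groupoid is trimedial if every subgroupoid (subset closed under $\cdot$) generated by $3$ elements is medial. *)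

(* Defs.v *)
Set Implicit Arguments.
Unset Strict Implicit.

Definition quasigroup (Q : Type) (op : Q -> Q -> Q) : Prop :=
  (forall a b : Q, exists! x : Q, op a x = b) /\
  (forall a b : Q, exists! y : Q, op y a = b).

(* Subsets of Q are predicates; the operation of a subgroupoid is the
   restriction of op. *)
Definition subgroupoid (Q : Type) (op : Q -> Q -> Q) (P : Q -> Prop) : Prop :=
  forall x y : Q, P x -> P y -> P (op x y).

Definition generated (Q : Type) (op : Q -> Q -> Q) (S : Q -> Prop) : Q -> Prop :=
  fun x => forall P : Q -> Prop,
    subgroupoid op P -> (forall s : Q, S s -> P s) -> P x.

Definition medial_on (Q : Type) (op : Q -> Q -> Q) (P : Q -> Prop) : Prop :=
  forall w x y z : Q, P w -> P x -> P y -> P z ->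
    op (op w x) (op y z) = op (op w y) (op x z).

(* The three generators are not required to be distinct. *)
Definition trimedial (Q : Type) (op : Q -> Q -> Q) : Prop :=
  forall a b c : Q,
    medial_on op (generated op (fun s => s = a \/ s = b \/ s = c)).

(* Main.v *)
(* Both identities give autotopisms of the quasigroup, and comparing products of these
   autotopisms yields the missing left semimedial law (xx)(yz) = (xy)(xz). Put e = aa. In
   the loop u + v = (u/e)(e\v) the two semimedial laws say that u -> u + p, u -> u + theta p,
   u -> u + (p + theta p) form an autotopism, and similarly on the left, where
   theta (ye) = ey is an automorphism; such a loop is commutative Moufang and
   p - theta p is always central. Modulo the centre, xy becomes -x - y and a becomes 0.
   Therefore a subloop generated by b, c and the centre contains a and is closed under the
   quasigroup product. It is associative, because the inner mappings of a commutative
   Moufang loop are automorphisms, and on it x -> xe and x -> ex are affine, which gives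
   mediality. *)

From Stdlib Require Import ssreflect IndefiniteDescription.
Require Import Defs.

Set Implicit Arguments.
Unset Strict Implicit.

(** * Commutative inverse property loops and their centre *)

Definition central (T : Type) (add : T -> T -> T) (z : T) : Prop :=
  forall u w, add (add u w) z = add u (add w z).

Record comm_ip_loop (T : Type) (add : T -> T -> T) (zero : T) (opp : T -> T)
    : Prop := {
  ip_addC : forall x y, add x y = add y x;
  ip_add0 : forall x, add x zero = x;
  ip_addK : forall x y, add (add x y) (opp y) = x
}.

Section CommIPLoop.

Context (T : Type) (add : T -> T -> T) (zero : T) (opp : T -> T).
Context (Hip : comm_ip_loop add zero opp).

Local Notation "x + y" := (add x y).
Local Notation "- x" := (opp x).

Let addC := ip_addC Hip.
Let addr0 := ip_add0 Hip.
Let addrK := ip_addK Hip.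

Lemma add0r x : add zero x = x.
Proof. by rewrite addC addr0. Qed.

Lemma addrN x : x + - x = zero.
Proof. by rewrite -{1}(add0r x) addrK. Qed.

Lemma addNr x : - x + x = zero.
Proof. by rewrite addC addrN. Qed.

Lemma opprK x : - - x = x.
Proof. by rewrite -[RHS](addrK x (- x)) addrN add0r. Qed.

Lemma addrNK x y : (x + - y) + y = x.
Proof. by rewrite -{2}(opprK y) addrK. Qed.

Lemma addKr x y : - x + (x + y) = y.
Proof. by rewrite addC (addC x) addrK. Qed.

Lemma addNKr x y : x + (- x + y) = y.
Proof. by rewrite addC (addC (- x)) addrNK. Qed.

Lemma addIr x y z : y + x = z + x -> y = z.
Proof. by move=> E; rewrite -(addrK y x) E addrK. Qed.

Lemma opp_unique x y : x + y = zero -> x = - y.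
Proof. by move=> E; apply: (addIr (x := y)); rewrite E addNr. Qed.

(** The nuclei of an inverse property loop coincide: writing [s] as [- (n + y)] gives [s + n = - y],
    and adding [y] to either side of the claim leaves [t]. *)
Lemma middle_nuclear_central n :
  (forall u w, (u + n) + w = u + (n + w)) -> central add n.
Proof.
move=> Hn t s.
have Hs : n + (- s + - n) = - s by rewrite addC addrNK.
have E : t + s = t + - (n + (- s + - n)) by rewrite Hs opprK.
rewrite E; set y := - s + - n.
have Ey : s + n = - y.
  by apply: opp_unique; rewrite Hn Hs addrN.
rewrite Ey; apply: (addIr (x := y)).
by rewrite Hn !addrNK.
Qed.

Lemma centralCA z u w : central add z -> (u + z) + w = u + (z + w).
Proof. by move=> Hz; rewrite (addC (u + z)) -Hz (addC w u) Hz (addC w z). Qed.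

Lemma central_zero : central add zero.
Proof. by move=> u w; rewrite !addr0. Qed.

Lemma central_add x y : central add x -> central add y -> central add (x + y).
Proof. by move=> Hx Hy u w; rewrite -!Hy Hx. Qed.

Lemma central_opp x : central add x -> central add (- x).
Proof.
by move=> Hx u w; apply: (addIr (x := x)); rewrite addrNK Hx addrNK.
Qed.

Lemma central_cancel x z : central add (x + z) -> central add z -> central add x.
Proof.
move=> Hxz Hz; rewrite -(addrK x z).
by apply: central_add => //; apply: central_opp.
Qed.

End CommIPLoop.

(** * Commutative Moufang loops and associativity of two-generated subloops *)

Record cml (T : Type) (add : T -> T -> T) (zero : T) (opp : T -> T)
    : Prop := {
  cml_ip : comm_ip_loop add zero opp;
  cml_moufang : forall p u w, add (add u p) (add w p) = add (add u w) (add p p)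
}.

(* Closed under opposites as well, since 3x is central in a commutative Moufang loop. *)
Inductive central_span2 (T : Type) (add : T -> T -> T) (b c : T) : T -> Prop :=
| span2_l : central_span2 add b c b
| span2_r : central_span2 add b c c
| span2_central z : central add z -> central_span2 add b c z
| span2_add x y : central_span2 add b c x -> central_span2 add b c y ->
    central_span2 add b c (add x y).

Section CML.

Context (T : Type) (add : T -> T -> T) (zero : T) (opp : T -> T).
Context (Hcml : cml add zero opp).

Local Notation "x + y" := (add x y).
Local Notation "- x" := (opp x).

Let Hip := cml_ip Hcml.
Let addC := ip_addC Hip.
Let addr0 := ip_add0 Hip.
Let addrK := ip_addK Hip.
Let moufang := cml_moufang Hcml.

Lemma add_double u p : (u + p) + p = u + (p + p).
Proof. by have := moufang p u zero; rewrite (add0r Hip) addr0. Qed.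

Lemma opp_double p : - (p + p) = - p + - p.
Proof.
symmetry; apply: (opp_unique Hip).
by rewrite addC -add_double addrK (addrN Hip).
Qed.

Lemma opp_add x y : - (x + y) = - x + - y.
Proof.
symmetry; apply: (opp_unique Hip); rewrite addC.
(* The third argument becomes [- x + - y] once [y] is added, and equals [- x + - (y + y)] by
   [add_double]. *)
have E := moufang y x ((- x + - y) + - y).
rewrite (addrNK Hip) in E; rewrite E.
by rewrite add_double -opp_double (addNKr Hip) (addNr Hip).
Qed.

Lemma moufang_rotated p u z : (z + (p + p)) + (u + - p) = (z + u) + p.
Proof.
have E := moufang p (- u) (z + u).
rewrite (addC (- u) (z + u)) addrK (addC (- u + p)) in E.
have -> : u + - p = - (- u + p) by rewrite opp_add (opprK Hip).
by rewrite -E addrK.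
Qed.

(** The map [u -> (u + p) + (p + p)] commutes with all translations, so it is the translation by its
    value at the unit. *)
Lemma central_triple p : central add (p + (p + p)).
Proof.
have F u w : ((u + p) + (p + p)) + w = ((u + w) + p) + (p + p).
  have := moufang_rotated p (w + p) (u + p).
  rewrite addrK => ->.
  by rewrite moufang -add_double add_double.
have F0 w : (p + (p + p)) + w = (w + p) + (p + p).
  by have := F zero w; rewrite !(add0r Hip).
move=> u w.
by rewrite addC F0 (addC w) F0 [RHS]addC F (addC w).
Qed.

(* The map [A u = ((u - (x + y)) + x) + y] is an automorphism: it preserves sums up to a third
   map by Moufang's identity, and it fixes the unit. Since [A u + (x + y) = (u + x) + y],
   its fixed points are the elements associating with x and y. *)
Lemma associating_add x y u w :
  (u + x) + y = u + (x + y) -> (w + x) + y = w + (x + y) ->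
  ((u + w) + x) + y = (u + w) + (x + y).
Proof.
set s := x + y.
pose A v := ((v + - s) + x) + y.
pose C v := ((v + (- s + - s)) + (x + x)) + (y + y).
have AC v v' : A v + A v' = C (v + v') by rewrite /A /C !moufang.
have A0 : A zero = zero.
  by rewrite /A (add0r Hip) /s opp_add (addC (- x)) (addrNK Hip) (addNr Hip).
have CA v : C v = A v by rewrite -(addr0 v) -AC A0 !addr0.
have AD v v' : A (v + v') = A v + A v' by rewrite -CA AC.
have As : A s = s by rewrite /A (addrN Hip) (add0r Hip).
have E v : A v + s = (v + x) + y.
  by rewrite -{1}As -AD /A addrK.
move=> Hu Hw.
have Au : A u = u by apply: (addIr (x := s) Hip); rewrite E.
have Aw : A w = w by apply: (addIr (x := s) Hip); rewrite E.
by rewrite -E AD Au Aw.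
Qed.

Context (b c : T).
Let H := central_span2 add b c.

Lemma span2_opp x : H x -> H (- x).
Proof.
move=> Hx.
have -> : - x = (x + x) + - (x + (x + x)).
  by apply: (addIr (x := x + (x + x)) Hip); rewrite (addrNK Hip) (addKr Hip).
apply: span2_add; first exact: span2_add.
by apply: span2_central; apply: (central_opp Hip); apply: central_triple.
Qed.

Lemma associating_span2 x y :
  (b + x) + y = b + (x + y) -> (c + x) + y = c + (x + y) ->
  forall u, H u -> (u + x) + y = u + (x + y).
Proof.
move=> Hb Hc u; elim=> //.
- move=> z Hz; rewrite (addC z x) (centralCA Hip) //.
  by rewrite (addC z (x + y)) Hz (addC z y).
- by move=> ? ? _ ? _ ?; apply: associating_add.
Qed.

Lemma associating_sym x y u :
  (u + x) + y = u + (x + y) -> (y + x) + u = y + (x + u).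
Proof. by move=> E; rewrite addC (addC y) -E addC (addC x). Qed.

Lemma flexible x y : (x + y) + x = x + (y + x).
Proof. by rewrite addC (addC y). Qed.

(* A middle argument may be split into summands, so it suffices to treat the generators. *)
Lemma span2_addA u x y : H u -> H x -> H y -> (u + x) + y = u + (x + y).
Proof.
have Hbb u' : H u' -> (u' + b) + b = u' + (b + b) by rewrite add_double.
have Hcc u' : H u' -> (u' + c) + c = u' + (c + c) by rewrite add_double.
have Hbc u' : H u' -> (u' + b) + c = u' + (b + c).
  apply: associating_span2; last exact: flexible.
  by apply: associating_sym; rewrite add_double.
have Hcb u' : H u' -> (u' + c) + b = u' + (c + b).
  apply: associating_span2; first exact: flexible.
  by apply: associating_sym; rewrite add_double.
have Hb u' y' : H u' -> H y' -> (u' + b) + y' = u' + (b + y').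
  move=> Hu' Hy'; apply: associating_span2 Hu'; apply: associating_sym.
    exact: Hbb.
  exact: Hbc.
have Hc u' y' : H u' -> H y' -> (u' + c) + y' = u' + (c + y').
  move=> Hu' Hy'; apply: associating_span2 Hu'; apply: associating_sym.
    exact: Hcb.
  exact: Hcc.
move=> Hu Hx; elim: Hx u y Hu => [u y|u y|z Hz u y _ _|x1 x2 Hx1 IH1 Hx2 IH2 u y Hu Hy].
- exact: Hb.
- exact: Hc.
- exact: (centralCA Hip).
- have Hu1 : H (u + x1) by apply: span2_add.
  have H2y : H (x2 + y) by apply: span2_add.
  by rewrite -(IH1 u x2) // (IH2 (u + x1)) // (IH1 u (x2 + y)) //
    -(IH2 x1).
Qed.

End CML.

(** * Loops with the two semimedial autotopisms are commutative Moufang *)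

Record theta_loop (T : Type) (add : T -> T -> T) (zero : T) (theta : T -> T)
    : Prop := {
  tl_add0 : forall x, add x zero = x;
  tl_0add : forall x, add zero x = x;
  tl_addI : forall x y z, add x y = add x z -> y = z;
  tl_addIr : forall x y z, add y x = add z x -> y = z;
  tl_solvel : forall x y, exists z, add z x = y;
  tl_solver : forall x y, exists z, add x z = y;
  tl_thetaD : forall x y, theta (add x y) = add (theta x) (theta y);
  tl_theta_surj : forall y, exists x, theta x = y;
  tl_theta_inj : forall x y, theta x = theta y -> x = y;
  tl_right : forall p u w,
    add (add u p) (add w (theta p)) = add (add u w) (add p (theta p));
  tl_left : forall p u w,
    add (add p u) (add (theta p) w) = add (add p (theta p)) (add u w)
}.

Section ThetaLoop.

Context (T : Type) (add : T -> T -> T) (zero : T) (theta : T -> T).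
Context (Htl : theta_loop add zero theta).

Local Notation "x + y" := (add x y).
Let addr0 := tl_add0 Htl.
Let add0r := tl_0add Htl.
Let addI := tl_addI Htl.
Let addIr := tl_addIr Htl.
Let thetaD := tl_thetaD Htl.
Let right := tl_right Htl.
Let left := tl_left Htl.

Lemma theta_rr p u : u + (p + theta p) = (u + p) + theta p.
Proof. by have := right p u zero; rewrite addr0 add0r. Qed.

Lemma theta_rl p w : w + (p + theta p) = p + (w + theta p).
Proof. by have := right p zero w; rewrite !add0r. Qed.

Lemma theta_lr p u : (p + theta p) + u = (p + u) + theta p.
Proof. by have := left p u zero; rewrite !addr0. Qed.

Lemma theta_ll p w : (p + theta p) + w = p + (theta p + w).
Proof. by have := left p zero w; rewrite addr0 add0r. Qed.

(** Conjugation by [p] as a relation, which avoids naming a right division. *)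
Let conj p w w' := w' + p = p + w.

(** Cancel [theta p] on the right; [conj_sum_r] cancels [p] on the left. Hence [p] and [theta p]
    conjugate alike. *)
Lemma conj_sum_l p w w' : conj (p + theta p) w w' <-> conj p w w'.
Proof.
rewrite /conj theta_rr theta_lr; split=> [|-> //].
exact: addIr.
Qed.

Lemma conj_sum_r p w w' : conj (p + theta p) w w' <-> conj (theta p) w w'.
Proof.
rewrite /conj theta_rl theta_ll; split=> [|-> //].
exact: addI.
Qed.

(** [theta] carries conjugation by [v] to conjugation by [theta v], which is the same relation. *)
Lemma conj_theta v w w' : conj v w w' -> conj v (theta w) (theta w').
Proof.
move=> E; apply/conj_sum_l/conj_sum_r.
by rewrite /conj -!thetaD E.
Qed.

Lemma conj_add v w w' x x' : conj v w w' -> conj v x x' -> conj v (w + x) (w' + x').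
Proof.
move=> Ew Ex; apply/conj_sum_l.
have /conj_sum_r Ex' : conj (v + theta v) x x' by apply/conj_sum_l.
by rewrite /conj -left -Ew -Ex' right.
Qed.

(* Conjugation by v is an automorphism that commutes with [theta], so it maps p + theta p to
   p' + theta p'. Expanding v + (p + theta p) through both halves shows
   theta p' = theta p. *)
Lemma theta_loop_comm v r : v + r = r + v.
Proof.
have [p Ep] := tl_theta_surj Htl r.
have [p' Cp] := tl_solvel Htl v (v + p).
have Cq : conj v (theta p) (theta p') by apply: conj_theta.
have Cu : conj v (p + theta p) (p' + theta p') by apply: conj_add.
have [v' Ev'] := tl_solver Htl (p + theta p) (v + (p + theta p)).
have Evp : v + p = p + v'.
  by apply: (addIr (x := theta p)); rewrite -theta_rr -theta_lr.
have E : theta p' = theta p.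
  apply: (addI (x := p + v')).
  by rewrite -theta_lr Ev' -{1}Evp -Cp -theta_lr Cu.
by rewrite -Ep -Cq E.
Qed.

Let addC := theta_loop_comm.

Lemma theta_swap p u w :
  (u + theta p) + (w + p) = (u + w) + (p + theta p).
Proof. by rewrite addC right (addC w). Qed.

Context (opp : T -> T) (Hopp : forall x, opp x + x = zero).

(** For [q = theta p], the right law with [w = opp q], compared with [theta_swap], gives
    [(u + opp q) + q = u]; and [theta] is onto. *)
Lemma theta_loop_ip : comm_ip_loop add zero opp.
Proof.
have NK u q : (u + opp q) + q = u.
  have [p <-] := tl_theta_surj Htl q.
  have E := right p u (opp (theta p)).
  rewrite Hopp addr0 in E.
  apply: (addIr (x := p)); rewrite E.
  have := theta_swap p (u + opp (theta p)) zero.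
  by rewrite addr0 add0r.
split=> // x y.
have [z Ez] := tl_solvel Htl (opp y) x.
by rewrite -Ez NK.
Qed.

Let Hip := theta_loop_ip.

(** By [right] and [theta_swap], the map [M U = (U + opp (theta p)) + p] satisfies
    [M U + W = U + M W]. Setting [W = zero] shows that [M] adds [p + opp (theta p)], which is thus
    middle nuclear. *)
Lemma theta_sub_central p : central add (p + opp (theta p)).
Proof.
apply: (middle_nuclear_central Hip) => u w.
have E U W : ((U + opp (theta p)) + p) + W = U + ((W + opp (theta p)) + p).
  have := right p (U + opp (theta p)) (W + opp (theta p)).
  by rewrite -theta_swap !(addrNK Hip).
have E0 U : (U + opp (theta p)) + p = U + (p + opp (theta p)).
  by have := E U zero; rewrite addr0 add0r (addC (opp _)).
by rewrite -E0 E E0 (addC w).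
Qed.

(** As [p] and [theta p] differ by a central element, the right law turns into the Moufang
    identity. *)
Lemma theta_loop_cml : cml add zero opp.
Proof.
split; first exact: Hip.
move=> p u w.
have Hn := theta_sub_central p.
set n := p + opp (theta p) in Hn.
have Eq : theta p + n = p by rewrite /n addC (addrNK Hip).
have Ew : w + p = (w + n) + theta p.
  by rewrite (centralCA Hip) // (addC n) Eq.
rewrite Ew right -Hn (centralCA Hip) //.
by rewrite (addC n) Hn Eq.
Qed.

End ThetaLoop.

(** * Division operations of a quasigroup *)

Record division (Q : Type) (mul ld rd : Q -> Q -> Q) : Prop := {
  mul_ld : forall a b, mul a (ld a b) = b;
  mul_rd : forall a b, mul (rd b a) a = b;
  mulI : forall a x y, mul a x = mul a y -> x = y;
  mulIr : forall a x y, mul x a = mul y a -> x = y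
}.

Lemma quasigroup_division (Q : Type) (op : Q -> Q -> Q) :
  quasigroup op -> exists ld rd, division op ld rd.
Proof.
move=> [Hl Hr].
have [ld Hld] : exists f : Q -> Q -> Q, forall a b, op a (f a b) = b.
  have [f Hf] : exists f : Q * Q -> Q, forall ab, op (fst ab) (f ab) = snd ab.
    apply: (functional_choice (fun ab x => op (fst ab) x = snd ab)) => -[a b].
    by have [x [Hx _]] := Hl a b; exists x.
  by exists (fun a b => f (a, b)) => a b; apply: (Hf (a, b)).
have [rd Hrd] : exists f : Q -> Q -> Q, forall a b, op (f b a) a = b.
  have [f Hf] : exists f : Q * Q -> Q, forall ab, op (f ab) (fst ab) = snd ab.
    apply: (functional_choice (fun ab x => op x (fst ab) = snd ab)) => -[a b].
    by have [x [Hx _]] := Hr a b; exists x.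
  by exists (fun b a => f (a, b)) => a b; apply: (Hf (a, b)).
exists ld, rd; split=> // a x y E.
- have [z [_ Hz]] := Hl a (op a y).
  by rewrite -(Hz x E) (Hz y).
- have [z [_ Hz]] := Hr a (op y a).
  by rewrite -(Hz x E) (Hz y).
Qed.

(** * The left semimedial law from the two identities *)

Section Semimedial.

Context (Q : Type) (mul ld rd : Q -> Q -> Q).
Context (Hq : division mul ld rd).

Local Notation "x * y" := (mul x y).
Local Notation "a \ b" := (ld a b) (at level 40, left associativity).
Local Notation "b / a" := (rd b a).

Let mulld := mul_ld Hq.
Let mulrd := mul_rd Hq.
Let mulI := mulI Hq.
Let mulIr := mulIr Hq.

Lemma mulK a b : a \ (a * b) = b.
Proof. by apply: (mulI (a := a)); rewrite mulld. Qed.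

Lemma mulrK a b : (b * a) / a = b.
Proof. by apply: (mulIr (a := a)); rewrite mulrd. Qed.

Context (right_semimedial : forall x y z, (y * z) * (x * x) = (y * x) * (z * x)).
Context (kepka : forall x u v, (x * (x * x)) * (u * v) = (x * u) * ((x * x) * v)).

(* Let beta_x and gamma_x be the autotopisms given by the two identities. The products
   gamma_(yx) beta_x and beta_(xx) gamma_y have the same first component, so their
   quotient is trivial there: it relates v to v' and makes uv' a function of uv. *)
Lemma nuclear_shift_aux x y u v v' :
  ((y * y) * (x * x)) * (v * x) = ((y * y) * x) * (v' * x) ->
  ((y * (y * y)) * (u * v')) * ((x * x) * (x * x)) =
  ((y * x) * ((y * x) * (y * x))) * ((u * v) * (x * x)).
Proof.
move=> E.
rewrite kepka right_semimedial (right_semimedial x (y * y)) -E.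
by rewrite (right_semimedial x u) kepka -!right_semimedial.
Qed.

Lemma nuclear_shift_right x y u v v' u2 v2 v2' :
  ((y * y) * (x * x)) * v = ((y * y) * x) * v' ->
  ((y * y) * (x * x)) * v2 = ((y * y) * x) * v2' ->
  u * v = u2 * v2 -> u * v' = u2 * v2'.
Proof.
rewrite -(mulrd x v) -(mulrd x v') -(mulrd x v2) -(mulrd x v2').
rewrite -(mulrd x u) -(mulrd x u2) => E E2.
rewrite -!right_semimedial => /mulIr Euv.
congr (_ * _).
have F := nuclear_shift_aux (u / x) E.
have F2 := nuclear_shift_aux (u2 / x) E2.
rewrite Euv -F2 in F.
exact: (mulI (mulIr F)).
Qed.

(** Left multiplication by [y * (y * y)], with [y = x * x], reduces the claim by [kepka] to
    [nuclear_shift_right]. *)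
Lemma nuclear_shift x u t t' u2 t2 t2' :
  (x * x) * t = x * t' -> (x * x) * t2 = x * t2' ->
  u * t = u2 * t2 -> u * t' = u2 * t2'.
Proof.
move=> E E2 Eut.
pose y := x * x; apply: (mulI (a := y * (y * y))).
rewrite !kepka.
by apply: (@nuclear_shift_right x x _ (y * y * t) _ _ (y * y * t2));
  rewrite -!kepka ?E ?E2 ?Eut.
Qed.

(** [nuclear_shift] turns [y * t = x * t2] into [y * z = (x * x) * t2]; two uses of [kepka] then
    finish. *)
Lemma left_semimedial x y z : (x * x) * (y * z) = (x * y) * (x * z).
Proof.
pose t := (x * x) \ (x * z).
have Et : (x * x) * t = x * z by rewrite mulld.
pose t2 := x \ (y * t).
have Et2 : x * t2 = y * t by rewrite mulld.
have -> : y * z = (x * x) * t2.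
  rewrite (@nuclear_shift x y t z x t2 (x \ ((x * x) * t2))) ?mulld //.
by rewrite -kepka Et2 kepka Et.
Qed.

End Semimedial.

(** * The loop isotope at [e = a * a] and the product modulo its centre *)

Section SemimedialLoop.

Context (Q : Type) (mul ld rd : Q -> Q -> Q).
Context (Hq : division mul ld rd).

Local Notation "x * y" := (mul x y).
Local Notation "a \ b" := (ld a b) (at level 40, left associativity).
Local Notation "b / a" := (rd b a).

Let mulld := mul_ld Hq.
Let mulrd := mul_rd Hq.
Let mulI := mulI Hq.
Let mulIr := mulIr Hq.
Let mulK := mulK Hq.
Let mulrK := mulrK Hq.

Context (left_semi : forall x y z, (x * x) * (y * z) = (x * y) * (x * z)).
Context (right_semi : forall x y z, (y * z) * (x * x) = (y * x) * (z * x)).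
Context (shift : forall x u t t' u2 t2 t2',
  (x * x) * t = x * t' -> (x * x) * t2 = x * t2' ->
  u * t = u2 * t2 -> u * t' = u2 * t2').
Context (a : Q).

Let e := a * a.
Let zero := e * e.
Let add u v := (u / e) * (e \ v).
Let theta p := e * (p / e).
Let opp x := (zero / (e \ x)) * e.

Local Notation "x + y" := (add x y).
Local Notation "- x" := (opp x).

Lemma mul_decomp u v : u * v = u * e + e * v.
Proof. by rewrite /add mulrK mulK. Qed.

Lemma mul_ld_e x w : x * (e \ w) = x * e + w.
Proof. by rewrite mul_decomp mulld. Qed.

Lemma theta_mul y : theta (y * e) = e * y.
Proof. by rewrite /theta mulrK. Qed.

(** Here [e] must be the square of [a]; it lets one element be written with [e] on either side. *)
Lemma base_swap x : (a * x) * e = e * (x * a).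
Proof. by rewrite /e left_semi. Qed.

Lemma theta_loopP : theta_loop add zero theta.
Proof.
have surR y : exists x, y = x * e by exists (y / e); rewrite mulrd.
have surL y : exists x, y = e * x by exists (e \ y); rewrite mulld.
have sura y : exists x, y = a * x by exists (a \ y); rewrite mulld.
have surra y : exists x, y = x * a by exists (y / a); rewrite mulrd.
split.
- by move=> x; rewrite /add mulK mulrd.
- by move=> x; rewrite /add mulrK mulld.
- move=> x y z /mulI E; by rewrite -(mulld e y) E mulld.
- move=> x y z /mulIr E; by rewrite -(mulrd e y) E mulrd.
- move=> x y; exists ((y / (e \ x)) * e); by rewrite /add mulrK mulrd.
- move=> x y; exists (e * ((x / e) \ y)); by rewrite /add mulK mulld.
- move=> x y; have [U ->] := surR x; have [V ->] := surL y.
  rewrite -mul_decomp theta_mul.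
  have [T ET] := surR (U * V); have [S ES] := surR (e * U).
  have [V' EV] := surR (e * V).
  rewrite ET EV !theta_mul ES -mul_decomp.
  (* After this multiplication both sides equal [(e * e) * (U * V)]. *)
  apply: (mulIr (a := e * e)).
  by rewrite [RHS]right_semi -ES -EV -!left_semi ET.
- by move=> y; exists ((e \ y) * e); rewrite theta_mul mulld.
- by move=> x y /mulI E; rewrite -(mulrd e x) E mulrd.
(* With [p = (a * x) * e], [u = (U * a) * e] and [w = (a * W) * e] the law becomes
   [(U * x) * (W * x) = (U * W) * (x * x)]. The left law is the mirror image. *)
- move=> p u w.
  have [p' ->] := surR p; have [x ->] := sura p'.
  have [u' ->] := surR u; have [U ->] := surra u'.
  have [w' ->] := surR w; have [W ->] := sura w'.
  rewrite theta_mul -!mul_decomp (base_swap x) (base_swap W) -!mul_decomp.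
  rewrite -(right_semi a U x) -(right_semi a U W) -(left_semi a W x).
  by rewrite -(left_semi a x x) -/e -!mul_decomp right_semi.
- move=> p u w.
  have [p' ->] := surR p; have [x ->] := surra p'.
  have [u' ->] := surR u; have [U ->] := sura u'.
  have [w' ->] := surL w; have [W ->] := sura w'.
  rewrite theta_mul -!mul_decomp (base_swap U) -(base_swap x) -!mul_decomp.
  rewrite -(right_semi a x U) -(right_semi a x x) -(left_semi a x W).
  by rewrite -(left_semi a U W) -/e -!mul_decomp left_semi.
Qed.

Lemma add_opp_l x : - x + x = zero.
Proof. by rewrite /add /opp mulrK mulrd. Qed.

Lemma isotope_cml : cml add zero opp.
Proof. exact: (theta_loop_cml theta_loopP add_opp_l). Qed.

Let Hcml := isotope_cml.
Let Hip := cml_ip Hcml.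
Let addC := ip_addC Hip.
Let addr0 := ip_add0 Hip.

Lemma right_sub_left_central y : central add (y * e + - (e * y)).
Proof.
by have := theta_sub_central theta_loopP add_opp_l (y * e); rewrite theta_mul.
Qed.

Lemma left_eq_right_central y : exists2 z, central add z & e * y = y * e + z.
Proof.
have Hz := central_opp Hip (right_sub_left_central y).
exists (- (y * e + - (e * y))) => //.
by rewrite (opp_add Hcml) (opprK Hip) (addNKr Hip).
Qed.

(** In the loop, [shift] says that [B] commutes with translations, so [B] adds the central element
    [B zero]. *)
Lemma square_right_central x :
  exists2 z, central add z & (x * x) * e = x * e + z.
Proof.
set r := x * e; set s := (x * x) * e.
pose B W := - r + (s + W).
have Bshift U W : U + B W = B (U + W).
  have := @shift x (U / e) (e \ W) (e \ B W) (zero / e) (e \ (U + W)) (e \ B (U + W)).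
  rewrite !mul_ld_e !mulrd !(add0r Hip).
  by apply=> //; rewrite /B (addNKr Hip).
have EB U : U + B zero = B U by rewrite Bshift addr0.
exists (B zero); last by rewrite /B addr0 (addNKr Hip).
by move=> u w; rewrite EB -Bshift EB.
Qed.

(** Since [(X + Y) * (e * e) = X * e + B Y], adding [z] to [X * e] or to [B Y] has the same effect
    on [X + Y]. So [z] pulls back along [X -> X * e] to a middle nuclear element. *)
Lemma right_factor_central z : central add z ->
  exists2 z', central add z' & forall x y, y * e = x * e + z -> y = x + z'.
Proof.
move=> Hz.
pose B Y := e * ((e \ Y) * e).
have RB X Y : X * e + B Y = (X + Y) * (e * e).
  have -> : X + Y = (X / e) * (e \ Y) by [].
  by rewrite right_semi mulrd (mul_decomp X ((e \ Y) * e)).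
have [z' Ez'] : exists z', B z' = z + B zero.
  by exists (e * ((e \ (z + B zero)) / e)); rewrite /B mulK mulrd mulld.
have key X X1 Y Y1 : X1 * e = X * e + z -> B Y1 = z + B Y -> X1 + Y = X + Y1.
  move=> EX EY; apply: (mulIr (a := e * e)).
  by rewrite -!RB EX EY (centralCA Hip).
have Ez X X1 : X1 * e = X * e + z -> X1 = X + z'.
  by move=> EX; rewrite -(key _ _ _ _ EX Ez') addr0.
exists z' => //.
apply: (middle_nuclear_central Hip) => X Y.
pose Y1 := e * ((e \ (z + B Y)) / e).
have EY : B Y1 = z + B Y by rewrite /B /Y1 mulK mulrd mulld.
have step X' : (X' + z') + Y = X' + Y1.
  have EX : ((X' * e + z) / e) * e = X' * e + z by rewrite mulrd.
  by rewrite -(Ez _ _ EX) (key _ _ _ _ EX EY).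
by rewrite step -(add0r Hip Y1) -step (add0r Hip).
Qed.

Lemma square_central x : exists2 z, central add z & x * x = x + z.
Proof.
have [z Hz E] := square_right_central x.
have [z' Hz' E'] := right_factor_central Hz.
by exists z' => //; apply: E'.
Qed.

(** Modulo the centre, [x] is [x * x = x * e + e * x], hence twice [x * e]; and triples are
    central. *)
Lemma right_opp_central x : central add (x * e + x).
Proof.
have [z' Hz' E'] := square_central x.
have [z Hz E] := left_eq_right_central x.
apply: (central_cancel Hip _ Hz').
rewrite Hz' -E' (mul_decomp x x) E -!Hz.
apply: (central_add _ Hz).
exact: (central_triple Hcml).
Qed.

Lemma left_opp_central x : central add (e * x + x).
Proof.
have [z Hz ->] := left_eq_right_central x.
rewrite (centralCA Hip) // (addC z) -Hz.
by apply: (central_add _ Hz); apply: right_opp_central.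
Qed.

(** Modulo the centre, [a] is [a * a = e], and [e] is [e * e = zero]. *)
Lemma base_central : central add a.
Proof.
have [z Hz E] := square_central a.
have [z' Hz' E'] := square_central e.
apply: (central_cancel Hip _ Hz); rewrite -E -/e.
apply: (central_cancel Hip _ Hz'); rewrite -E'.
exact: (central_zero Hip).
Qed.

(** * Mediality on the subloop generated by [b], [c] and the centre *)

Context (b c : Q).
Let H := central_span2 add b c.

Lemma span2_mul_e x : H x -> H (x * e).
Proof.
move=> Hx; rewrite -(ip_addK Hip (x * e) x).
apply: span2_add; last exact: (span2_opp Hcml).
by apply: span2_central; apply: right_opp_central.
Qed.

Lemma span2_e_mul x : H x -> H (e * x).
Proof.
move=> Hx; rewrite -(ip_addK Hip (e * x) x).
apply: span2_add; last exact: (span2_opp Hcml).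
by apply: span2_central; apply: left_opp_central.
Qed.

Lemma span2_mul x y : H x -> H y -> H (x * y).
Proof.
move=> Hx Hy; rewrite mul_decomp.
by apply: span2_add; [apply: span2_mul_e | apply: span2_e_mul].
Qed.

Lemma span2_ld_zero : H (e \ zero).
Proof.
have := left_opp_central (e \ zero); rewrite mulld (add0r Hip) => Hz.
exact: span2_central.
Qed.

Lemma span2_rd_zero : H (zero / e).
Proof.
have := right_opp_central (zero / e); rewrite mulrd (add0r Hip) => Hz.
exact: span2_central.
Qed.

(* On the abelian group H, the two semimedial laws with one argument specialised make
   x -> xe and x -> ex affine. *)
Lemma span2_mul_e_add : exists2 d, H d &
  forall y z, H y -> H z -> (y * z) * e = (y * e) * e + ((e * z) * e + d).
Proof.
(* Right multiplication by [x0] agrees with that by [e], since [e * x0] is the unit. *)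
set x0 := e \ zero; have Hx0 : H x0 := span2_ld_zero.
set k := e * (x0 * x0).
have Ex0 w : w * x0 = w * e by rewrite mul_ld_e addr0.
have HR := span2_mul_e; have HL := span2_e_mul.
have E y z : (y * z) * e + k = (y * e) * e + e * (z * e).
  by rewrite /k -!mul_decomp right_semi !Ex0.
have E0 z : (e * z) * e + k = zero * e + e * (z * e).
  have := E (zero / e) z.
  by rewrite mulrd (mul_decomp (zero / e) z) mulrd (add0r Hip).
have Hzero : H zero by apply: span2_central; apply: (central_zero Hip).
have Hd : H (- (zero * e)) by apply: (span2_opp Hcml); apply: HR.
have Hk : H k by apply: HL; apply: span2_mul.
exists (- (zero * e)) => // y z Hy Hz.
have HA : H ((y * e) * e) by apply/HR/HR.
have HB : H ((e * z) * e) by apply/HR/HL.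
apply: (addIr (x := k) Hip).
rewrite E -[e * (z * e)](addKr Hip (zero * e)) -E0 (addC _ (- (zero * e))).
rewrite -!(span2_addA Hcml (b := b) (c := c)) //; exact: span2_add.
Qed.

Lemma span2_e_mul_add : exists2 d, H d &
  forall y z, H y -> H z -> e * (y * z) = (e * y) * e + (e * (e * z) + d).
Proof.
set x1 := zero / e; have Hx1 : H x1 := span2_rd_zero.
set k := (x1 * x1) * e.
have Ex1 w : x1 * w = e * w by rewrite (mul_decomp x1) mulrd (add0r Hip).
have HR := span2_mul_e; have HL := span2_e_mul.
have E y z : k + e * (y * z) = (e * y) * e + e * (e * z).
  by rewrite /k -!mul_decomp left_semi !Ex1.
have Hk : H k by apply: HR; apply: span2_mul.
exists (- k); first exact: (span2_opp Hcml).
move=> y z Hy Hz.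
have HA : H ((e * y) * e) by apply/HR/HL.
have HB : H (e * (e * z)) by apply/HL/HL.
have Hnk : H (- k) by apply: (span2_opp Hcml).
by rewrite -(span2_addA Hcml HA HB Hnk) -E addC (addKr Hip).
Qed.

(** By the affine formulas, [x] and [y] enter [(w * x) * (y * z)] only through the summands
    [(e * x) * e] and [(e * y) * e], which may be exchanged in the abelian group. *)
Lemma span2_medial : medial_on mul H.
Proof.
have [d Hd Ed] := span2_mul_e_add; have [d' Hd' Ed'] := span2_e_mul_add.
have HR := span2_mul_e; have HL := span2_e_mul.
have swap A D : H A -> H D -> forall X Y, H X -> H Y ->
    (A + (X + d)) + (Y + D) = (A + (Y + d)) + (X + D).
  move=> HA HD.
  have F X Y : H X -> H Y -> (A + (X + d)) + (Y + D) = A + ((X + Y) + (d + D)).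
    move=> HX HY.
    have HXd : H (X + d) by apply: span2_add.
    have HYD : H (Y + D) by apply: span2_add.
    have HdD : H (d + D) by apply: span2_add.
    rewrite (span2_addA Hcml HA HXd HYD) (span2_addA Hcml HX Hd HYD).
    rewrite -(span2_addA Hcml Hd HY HD) (addC d Y) (span2_addA Hcml HY Hd HD).
    by rewrite (span2_addA Hcml HX HY HdD).
  by move=> X Y HX HY; rewrite !F // (addC X Y).
move=> w x y z Hw Hx Hy Hz.
rewrite (mul_decomp (w * x)) (mul_decomp (w * y)) (Ed w x) // (Ed w y) //.
rewrite (Ed' y z) // (Ed' x z) //.
by apply: swap;
  [apply/HR/HR | apply: span2_add Hd'; apply/HL/HL | apply/HR/HL | apply/HR/HL].
Qed.

Lemma generated_medial : medial_on mul (generated mul (fun s => s = a \/ s = b \/ s = c)).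
Proof.
have sub s : generated mul (fun s => s = a \/ s = b \/ s = c) s -> H s.
  move=> Hs; apply: Hs; first exact: span2_mul.
  move=> t [->|[->|->]]; [ | exact: span2_l | exact: span2_r].
  by apply: span2_central; apply: base_central.
by move=> w x y z /sub Hw /sub Hx /sub Hy /sub Hz; apply: span2_medial.
Qed.

End SemimedialLoop.

(** * Trimediality and the two identities *)

Theorem mainTheorem1 (Q : Type) (op : Q -> Q -> Q) (hQ : quasigroup op) :
  trimedial op <->
  (forall x y z : Q, op (op y z) (op x x) = op (op y x) (op z x)) /\
  (forall x u v : Q,
     op (op x (op x x)) (op u v) = op (op x u) (op (op x x) v)).
Proof.
split=> [Htri | [HB HC] a b c].
(* Each identity is an instance of mediality in the subgroupoid generated by its three variables. *)
- have gen a b c : let P := generated op (fun s => s = a \/ s = b \/ s = c) in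
      medial_on op P /\ P a /\ P b /\ P c /\ forall x y, P x -> P y -> P (op x y).
    split; first exact: Htri.
    split; first by move=> P _; apply; left.
    split; first by move=> P _; apply; right; left.
    split; first by move=> P _; apply; right; right.
    by move=> x y Hx Hy P HP HS; apply: (HP); [apply: Hx | apply: Hy].
  split=> x y z; have [M [Px [Py [Pz PM]]]] := gen x y z.
    exact: M.
  by apply: M => //; apply: PM.
- have [ld [rd Hd]] := quasigroup_division hQ.
  apply: (generated_medial Hd) => //.
    exact: (left_semimedial Hd).
  exact: (nuclear_shift Hd).
Qed.
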